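(* Let $p$ be a prime, $n\ge 1$ an integer, $\mathbb{F}=\mathbb{F}_{p^n}$ and $F=p^n$. Let $k$ be an integer with $2\le k\le F$, and let $\theta$ and $\delta\ge 0$ be real numbers. Suppose $f,g:\mathbb{F}\to[0,1]$ satisfy $f(m)\ge g(m)\ge 0$ for all $m\in\mathbb{F}$, and $$\mathbb{E}(f)\ \ge\ \mathbb{E}(g)\ \ge\ \max\left(F^{-\theta},\ 8p^{-1/2}k^{-1}\right).$$ Suppose further that $\sigma_k\le \delta^2F^2$. Then $$\Lambda_3(f,g,f)\ \ge\ \frac{p^{-2}\binom{k}{2}^{-1}F^{-4\theta}}{128}-\frac{9\delta F^{-2\theta}}{8}\quad\text{and}\quad \Lambda_3(g,f,f)\ \ge\ \frac{p^{-2}\binom{k}{2}^{-1}F^{-4\theta}}{128}-\frac{9\delta F^{-2\theta}}{8}.$$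
   Context: For $h:\mathbb{F}\to\mathbb{C}$, $\mathbb{E}(h)=F^{-1}\sum_{m\in\mathbb{F}}h(m)$. Identify $\mathbb{F}$ with $\mathbb{F}_p^n$ via a fixed standard $\mathbb{F}_p$-basis, and let $a\cdot m$ be the dot product. With $\omega=e^{2\pi i/p}$, $\hat h(a)=\sum_{m}h(m)\omega^{a\cdot m}$. Enumerate $\mathbb{F}=\{a_1,\dots,a_F\}$ so that $|\hat f(a_1)|\ge|\hat f(a_2)|\ge\cdots\ge|\hat f(a_F)|$ and put $f_j=\hat f(a_j)$; then $\sigma_i=\sum_{i<j\le F}|f_j|^2$ (the tail of the spectral $L^2$ norm of $\hat f$). For $f_1,f_2,f_3:\mathbb{F}\to\mathbb{C}$ (here meaning functions), $\Lambda_3(f_1,f_2,f_3)=F^{-2}\sum_{m,d\in\mathbb{F}}f_1(m)f_2(m+d)f_3(m+2d)$. *)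

(* Defs.v *)
From HB Require Import structures.
From mathcomp Require Import all_boot all_order all_algebra.
From mathcomp Require Import all_classical all_reals all_analysis.
From mathcomp Require Import complex.
Set Implicit Arguments. Unset Strict Implicit. Unset Printing Implicit Defensive.
Import Order.TTheory GRing.Theory Num.Theory.
Local Open Scope ring_scope.

(* The field F_{p^n}, as an additive group with the dot product coming from a
   fixed F_p-basis, is identified with the row space 'rV['F_p]_n = F_p^n.
   Only this additive structure and the dot product are used below. *)
Notation Fvec p n := 'rV['F_p]_n.

Section Defs.
Variable R : realType.
Variables (p n : nat).

Definition Fcard : R := (#|{: Fvec p n}|)%:R.

Definition Eavg (h : Fvec p n -> R) : R := Fcard^-1 * \sum_(m : Fvec p n) h m.

Definition dotF (a m : Fvec p n) : 'F_p := \sum_(i < n) a 0 i * m 0 i.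

Definition omega : R[i] := Complex (cos (2 * pi / p%:R)) (sin (2 * pi / p%:R)).

Definition fhat (h : Fvec p n -> R) (a : Fvec p n) : R[i] :=
  \sum_(m : Fvec p n) (h m)%:C%C * omega ^+ (nat_of_ord (dotF a m)).

Definition sigma (h : Fvec p n -> R) (i : nat) : R :=
  \sum_(x <- drop i (sort (fun x y : R => y <= x)
                   [seq ComplexField.Normc.normc (fhat h a) | a <- enum {: Fvec p n}])) x ^+ 2.

Definition Lambda3 (f1 f2 f3 : Fvec p n -> R) : R :=
  Fcard^-2 * \sum_(m : Fvec p n) \sum_(d : Fvec p n)
     f1 m * f2 (m + d) * f3 (m + d + d).

End Defs.

(* Main.v *)
Require Import Defs.
From HB Require Import structures.
From mathcomp Require Import all_boot all_order all_algebra.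
From mathcomp Require Import all_classical all_reals all_analysis.
From mathcomp Require Import complex ring lra.
Import Order.TTheory GRing.Theory Num.Theory.
Local Open Scope ring_scope.
Set Implicit Arguments. Unset Strict Implicit. Unset Printing Implicit Defensive.

(* Write a three-term count as the average over m and d of
   h(m) f(m + al d) f(m + be d), where (al, be) = (-1, 1) or (1, 2) and g has been
   truncated to h = min(g, E(g)^2/4).  Let S be the set of the k largest frequencies
   of f.  Replacing f by its part with spectrum in S changes the count by
   O(max h * delta), even if d is distributed according to an arbitrary probability
   measure mu; afterwards the count depends only on the Fourier coefficients of mu at
   the points al a + be b with a, b in S.  Since there are at most k^2 such points,
   convolving uniform measures on few lines gives a mu whose coefficients vanish at
   the nonzero ones, as those of the uniform measure do, but with
   mu(0) >= 1/(p k^2).  The contribution of d = 0 alone is then large enough. *)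

(** * Additive characters of F_p and of F_p^n, and their orthogonality *)

Section Characters.
Variables (R : realType) (p n : nat).
Hypothesis p_pr : prime p.

Let card_p : #|'F_p| = p. Proof. exact: card_Fp. Qed.

Lemma omegaX m :
  omega R p ^+ m = Complex (cos (2 * pi / p%:R * m%:R)) (sin (2 * pi / p%:R * m%:R)).
Proof.
elim: m => [|m IHm]; first by rewrite expr0 mulr0 cos0 sin0.
rewrite exprS IHm /omega; set x := 2 * pi / p%:R.
have -> : x * m.+1%:R = x + x * m%:R by rewrite mulrS mulrDr mulr1.
rewrite cosD sinD.
by apply/eqP; rewrite eq_complex /= eqxx [X in _ == X]addrC eqxx.
Qed.

Lemma omega_expp : omega R p ^+ p = 1.
Proof.
have p0 : (p%:R : R) != 0 by rewrite pnatr_eq0 -lt0n prime_gt0.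
by rewrite omegaX mulfVK // mulrC mulr_natr cos2pi sin2pi.
Qed.

(** If [omega] were 1, the double-angle formula would give sin(pi/p) = 0, although 0 < pi/p < pi. *)
Lemma omega_neq1 : omega R p != 1.
Proof.
have p2 : (2 : R) <= p%:R by rewrite (ler_nat _ 2) prime_gt1.
have p_gt0 : (0 : R) < p%:R by rewrite (lt_le_trans _ p2).
have x_gt0 : 0 < pi / p%:R :> R by rewrite divr_gt0 ?pi_gt0.
have x_lt : pi / p%:R < pi :> R.
  by rewrite ltr_pdivrMr // ltr_pMr ?pi_gt0 // (ltr_nat _ 1) prime_gt1.
have s_gt0 : 0 < sin (pi / p%:R) :> R by rewrite sin_gt0_pi // x_gt0.
apply/eqP => /(congr1 (@complex.Re R)) /=.
have := cos2Dsin2 (pi / p%:R : R).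
rewrite -mulrA mulr_natl mulr2n cosD; nra.
Qed.

Definition echar (t : 'F_p) : R[i] := omega R p ^+ (nat_of_ord t).

Lemma echarD s t : echar (s + t) = echar s * echar t.
Proof.
(* Addition in ['F_p] reduces representatives modulo p, which is harmless in the exponent since
   [omega] is a p-th root of unity. *)
rewrite /echar -exprD /= [X in omega _ _ ^+ (_ %% X)](Fp_cast p_pr).
exact: expr_mod omega_expp.
Qed.

Lemma echar0 : echar 0 = 1. Proof. exact: expr0. Qed.

Lemma echarVr t : echar t * echar (- t) = 1.
Proof. by rewrite -echarD subrr echar0. Qed.

Lemma normr_echar t : `|echar t| = 1.
Proof.
rewrite /echar normrX; apply/eqP.
have: `|omega R p| ^+ p == 1 by rewrite -normrX omega_expp normr1.
by rewrite pexprn_eq1 ?prime_gt0 // gtn_eqF ?prime_gt0 //= => /eqP ->; rewrite expr1n.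
Qed.

Lemma conjc_echar t : (echar t)^*%C = echar (- t).
Proof.
have nz : echar t != 0 by rewrite -normr_gt0 normr_echar ltr01.
by apply: (mulfI nz); rewrite -sqr_normc normr_echar expr1n echarVr.
Qed.

Lemma echar_eq1 t : (echar t == 1) = (t == 0).
Proof.
apply/idP/eqP => [/eqP e1|->]; last by rewrite echar0.
apply/eqP/contraT => t0; case/eqP: omega_neq1.
have t_gt0 : (0 < t)%N by rewrite lt0n.
have cop : coprime t p.
  rewrite coprime_sym prime_coprime // gtnNdvd //.
  by rewrite -[X in (_ < X)%N](Fp_cast p_pr) ltn_ord.
(* Bezout: u t = v p + 1, so raising [echar t = 1] to the power u yields [omega = 1]. *)
case: (egcdnP p t_gt0) => u v def_u _.
rewrite (eqP cop) addn1 in def_u.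
have := expr1n (R[i]) u; rewrite -{1}e1 -exprM mulnC def_u exprS mulnC exprM.
by rewrite omega_expp expr1n mulr1.
Qed.

Lemma dotFC (a m : 'rV['F_p]_n) : dotF a m = dotF m a.
Proof. by apply: eq_bigr => i _; rewrite mulrC. Qed.

Lemma dotFDr (a m d : 'rV['F_p]_n) : dotF a (m + d) = dotF a m + dotF a d.
Proof. by rewrite /dotF -big_split; apply: eq_bigr => i _; rewrite mxE mulrDr. Qed.

Lemma dotFZr t (a m : 'rV['F_p]_n) : dotF a (t *: m) = t * dotF a m.
Proof. by rewrite /dotF mulr_sumr; apply: eq_bigr => i _; rewrite mxE mulrCA. Qed.

Lemma dotFDl (a b m : 'rV['F_p]_n) : dotF (a + b) m = dotF a m + dotF b m.
Proof. by rewrite dotFC dotFDr !(dotFC m). Qed.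

Lemma dotFZl t (a m : 'rV['F_p]_n) : dotF (t *: a) m = t * dotF a m.
Proof. by rewrite dotFC dotFZr dotFC. Qed.

Lemma dotFNr (a m : 'rV['F_p]_n) : dotF a (- m) = - dotF a m.
Proof. by rewrite -scaleN1r dotFZr mulN1r. Qed.

Lemma dotFNl (a m : 'rV['F_p]_n) : dotF (- a) m = - dotF a m.
Proof. by rewrite -scaleN1r dotFZl mulN1r. Qed.

(** Shifting t by 1 multiplies the sum by [echar s], which differs from 1 unless s = 0. *)
Lemma sum_echar_mul s : \sum_(t : 'F_p) echar (t * s) = if s == 0 then p%:R else 0.
Proof.
case: eqVneq => [->|s0].
  rewrite (eq_bigr (fun=> 1)) => [|t _]; last by rewrite mulr0 echar0.
  by rewrite sumr_const card_p.
have e : \sum_(t : 'F_p) echar (t * s) = echar s * \sum_(t : 'F_p) echar (t * s).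
  rewrite mulr_sumr (reindex_inj (addrI 1)); apply: eq_bigr => t _.
  by rewrite mulrDl mul1r echarD.
apply/eqP; move/eqP: e; rewrite -subr_eq0 -{1}[\sum_t _]mul1r -mulrBl mulf_eq0.
by rewrite subr_eq0 eq_sym echar_eq1 (negPf s0).
Qed.

Lemma card_Fvec : #|{: 'rV['F_p]_n}| = (p ^ n)%N.
Proof. by rewrite card_mx card_p mul1n. Qed.

Lemma FcardE : Fcard R p n = (p ^ n)%:R.
Proof. by rewrite /Fcard card_Fvec. Qed.

Lemma sum_echar_dot (a : 'rV['F_p]_n) :
  \sum_(m : 'rV['F_p]_n) echar (dotF a m) = if a == 0 then (p ^ n)%:R else 0.
Proof.
case: eqVneq => [->|/eqP a0].
  rewrite (eq_bigr (fun=> 1)) => [|m _]; first by rewrite sumr_const card_Fvec.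
  by rewrite -[X in dotF X _](scale0r 0) dotFZl mul0r echar0.
have [i ai] : exists i, a 0 i != 0.
  apply/existsP; apply: contraT; rewrite negb_exists => /forallP /= z.
  by case: a0; apply/rowP => i; rewrite mxE; apply/eqP; rewrite -[_ == _]negbK z.
have dm : dotF a (delta_mx 0 i) = a 0 i.
  rewrite /dotF (bigD1 i) //= mxE !eqxx mulr1 big1 ?addr0 // => j ji.
  by rewrite mxE (negPf ji) mulr0.
(* Shifting along a coordinate where a is nonzero multiplies the sum by a factor other than 1. *)
have e : \sum_m echar (dotF a m) = echar (a 0 i) * \sum_m echar (dotF a m).
  rewrite mulr_sumr (reindex_inj (addrI (delta_mx 0 i))); apply: eq_bigr => t _.
  by rewrite dotFDr dm echarD.
apply/eqP; move/eqP: e; rewrite -subr_eq0 -{1}[\sum_m _]mul1r -mulrBl mulf_eq0.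
by rewrite subr_eq0 eq_sym echar_eq1 (negPf ai).
Qed.

End Characters.

(** * Probability measures with prescribed vanishing Fourier coefficients *)

Section Measures.
Variables (R : realType) (p n : nat).
Hypothesis p_pr : prime p.
Local Notation V := 'rV['F_p]_n.

(** Double counting: in the sum of [echar (t * dotF v r)] over t and r, summing over t first detects
    orthogonality, while summing over r first leaves only t = 0. *)
Lemma card_dotF_eq0 (v : V) : v != 0 ->
  (p * #|[set r : V | (dotF v r == 0)%R]| = p ^ n)%N.
Proof.
move=> v0; apply/eqP; rewrite -(eqr_nat R[i]) natrM; apply/eqP.
transitivity (\sum_(r : V) \sum_(t : 'F_p) echar R (t * dotF v r)).
  under eq_bigr do rewrite (sum_echar_mul R p_pr).
  rewrite -big_mkcond /= sumr_const mulr_natr cardsE.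
  by congr (_ *+ _); apply: eq_card => r; rewrite inE.
rewrite exchange_big (bigD1 (0 : 'F_p)) //= [X in _ + X]big1 => [|t t0].
  under eq_bigr do rewrite mul0r echar0.
  by rewrite addr0 sumr_const card_Fvec.
under eq_bigr do rewrite -dotFZl.
by rewrite (sum_echar_dot _ p_pr) scaler_eq0 (negPf t0) (negPf v0).
Qed.

(** Averaging over r: every nonzero v is orthogonal to exactly a fraction 1/p of all r, so some r is
    orthogonal to at most |D|/p elements of D. *)
Lemma exists_separating_direction (D : {set V}) : 0 \notin D ->
  exists r : V, (p * #|[set v in D | (dotF v r == 0)%R]| <= #|D|)%N.
Proof.
move=> D0; apply/existsP; apply: contraT; rewrite negb_exists => /forallP /= H.
have : (\sum_(r : V) #|D|.+1 <= \sum_(r : V) p * #|[set v in D | (dotF v r == 0)%R]|)%N.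
  by apply: leq_sum => r _; rewrite ltnNge H.
have -> : (\sum_(r : V) p * #|[set v in D | (dotF v r == 0)%R]| = \sum_(v in D) p ^ n)%N.
  transitivity (\sum_(r : V) \sum_(v in D) (if (dotF v r == 0)%R then p else 0))%N.
    apply: eq_bigr => r _; rewrite -sum1_card big_distrr /= big_mkcond [RHS]big_mkcond.
    apply: eq_bigr => v _.
    by rewrite inE; case: (v \in D); case: (dotF v r == 0)%R; rewrite //= ?muln1.
  rewrite exchange_big; apply: eq_bigr => v vD.
  rewrite -(@card_dotF_eq0 v); last exact: (memPn D0).
  rewrite -sum1_card big_distrr /= [RHS]big_mkcond; apply: eq_bigr => r _.
  by rewrite inE muln1.
rewrite !sum_nat_const card_Fvec // mulnC leq_pmul2r ?ltnn //.
by rewrite expn_gt0 prime_gt0.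
Qed.

Definition mhat (mu : V -> R) (v : V) : R[i] :=
  \sum_(d : V) (mu d)%:C%C * echar R (dotF v d).

(* Convolving with the uniform measure on the line spanned by [r] kills the
   coefficients at all [v] not orthogonal to [r], and costs a factor [p] at 0. *)
Lemma exists_sparse_measure (j : nat) (D : {set V}) : 0 \notin D -> (#|D| < p ^ j)%N ->
  exists mu : V -> R, [/\ forall d, 0 <= mu d, \sum_d mu d = 1,
    (p ^ j)%:R^-1 <= mu 0 & {in D, forall v, mhat mu v = 0}].
Proof.
have p_gt0 : (0 : R) < p%:R by rewrite ltr0n prime_gt0.
elim: j D => [|j IHj] D D0.
  rewrite ltnS leqn0 cards_eq0 => /eqP ->.
  exists (fun d => (d == 0)%:R); split => [d||| v]; rewrite ?ler0n ?inE //.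
    by rewrite (bigD1 0) //= eqxx big1 ?addr0 // => d /negPf ->.
  by rewrite eqxx invr1.
have [r rP] := exists_separating_direction D0.
rewrite expnS => Dp; pose D' := [set v in D | dotF v r == 0].
have [||mu [mu0 mu1 muj muD]] := IHj D'.
- by rewrite inE (negPf D0).
- by rewrite -(ltn_pmul2l (prime_gt0 p_pr)) (leq_ltn_trans rP).
exists (fun d => p%:R^-1 * \sum_(t : 'F_p) mu (d - t *: r)); split => [d|||v vD].
- by rewrite mulr_ge0 ?invr_ge0 ?ler0n ?sumr_ge0.
- rewrite -mulr_sumr exchange_big /=.
  rewrite (eq_bigr (fun=> 1)) => [|t _].
    by rewrite sumr_const card_Fp // mulVf // gt_eqF.
  by rewrite -mu1 [RHS](reindex_inj (addIr (- (t *: r)))).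
- rewrite natrM invfM ler_pM2l ?invr_gt0 //.
  rewrite (bigD1 (0 : 'F_p)) //= scale0r subr0 (le_trans muj) // lerDl.
  exact: sumr_ge0.
rewrite /mhat.
transitivity ((p%:R^-1)%:C%C * (mhat mu v * \sum_(t : 'F_p) echar R (t * dotF v r))).
  rewrite mulr_sumr /mhat.
  under eq_bigr => d _ do rewrite rmorphM /= -mulrA rmorph_sum mulr_suml.
  rewrite -[LHS]mulr_sumr exchange_big; congr (_ * _); apply: eq_bigr => t _ /=.
  rewrite mulr_suml (reindex_inj (addIr (t *: r))); apply: eq_bigr => d _.
  by rewrite addrK dotFDr dotFZr (echarD R p_pr) mulrA.
rewrite (sum_echar_mul R p_pr); case: eqP => vr; last by rewrite !mulr0.
by rewrite muD ?mul0r ?mulr0 // inE vD vr eqxx.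
Qed.

End Measures.

(** * Fourier inversion, Parseval, and the spectral tail *)

Section Fourier.
Variables (R : realType) (p n : nat).
Hypothesis p_pr : prime p.
Local Notation V := 'rV['F_p]_n.
Local Notation N := ((p ^ n)%:R).
Local Notation normc := (@ComplexField.Normc.normc R).

Lemma Fpn_neq0 (K : numDomainType) : N != 0 :> K.
Proof. by rewrite pnatr_eq0 -lt0n expn_gt0 prime_gt0. Qed.

Lemma normcEC (z : R[i]) : `|z| = (normc z)%:C%C.
Proof. by []. Qed.

Lemma mhat_uniform (v : V) :
  mhat (fun=> N^-1 : R) v = if v == 0 then 1 else 0.
Proof.
rewrite /mhat -mulr_sumr (sum_echar_dot R p_pr).
case: ifP => _; rewrite ?mulr0 //.
by rewrite fmorphV rmorph_nat mulVf // Fpn_neq0.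
Qed.

(** The inversion formula restricted to the frequencies in S. Values are complex because S need not
    be closed under negation. *)
Definition fproj (f : V -> R) (S : {set V}) (m : V) : R[i] :=
  N^-1 * \sum_(a in S) fhat f a * echar R (dotF a (- m)).

Lemma fprojT f m : fproj f [set: V]%SET m = (f m)%:C%C.
Proof.
rewrite /fproj /fhat.
under eq_bigr => a _ do rewrite mulr_suml.
rewrite exchange_big (bigD1 m) //= [X in _ + X]big1 => [|x xm].
  rewrite addr0 (eq_bigr (fun=> (f m)%:C%C)) => [|a _].
    by rewrite sumr_const cardsT card_Fvec // -(mulr_natl (f m)%:C%C) mulKf // Fpn_neq0.
  by rewrite -mulrA -(echarD R p_pr) dotFNr subrr echar0 mulr1.
transitivity ((f x)%:C%C * \sum_(a : V) echar R (dotF (x - m) a)).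
  rewrite mulr_sumr; apply: eq_big => [a|a _]; first by rewrite inE.
  by rewrite -mulrA -[omega R p ^+ _]/(echar R _) -(echarD R p_pr) -dotFDr dotFC.
by rewrite (sum_echar_dot R p_pr) subr_eq0 (negPf xm) mulr0.
Qed.

Lemma fprojC f S m : fproj f (~: S) m = (f m)%:C%C - fproj f S m.
Proof.
rewrite -fprojT /fproj -mulrBr; congr (_ * _).
apply/esym/eqP; rewrite subr_eq (bigID (mem S)) addrC /=; apply/eqP.
by congr (_ + _); apply: eq_bigl => a; rewrite !inE.
Qed.

(** Expand the square into a double sum over frequencies a, b; orthogonality leaves the diagonal. *)
Lemma parseval_fproj f S :
  \sum_(m : V) normc (fproj f S m) ^+ 2 = N^-1 * \sum_(a in S) normc (fhat f a) ^+ 2.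
Proof.
apply: (@complexI R); rewrite rmorphM fmorphV rmorph_nat !rmorph_sum /=.
under eq_bigr => m _ do rewrite rmorphXn /= -normcEC sqr_normc.
under [in RHS]eq_bigr => a _ do rewrite rmorphXn /= -normcEC sqr_normc.
transitivity (\sum_(m : V) N^-1 ^+ 2 * \sum_(a in S) \sum_(b in S)
    fhat f a * (fhat f b)^*%C * echar R (dotF (b - a) m)).
  apply: eq_bigr => m _; rewrite rmorphM fmorphV rmorph_nat mulrACA -expr2.
  congr (_ * _); rewrite rmorph_sum mulr_suml; apply: eq_bigr => a _.
  rewrite mulr_sumr; apply: eq_bigr => b _.
  rewrite rmorphM mulrACA; congr (_ * _).
  by rewrite [X in _ * X](conjc_echar R p_pr) -(echarD R p_pr) !dotFNr opprK dotFDl dotFNl addrC.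
rewrite -mulr_sumr expr2 -mulrA; congr (_ * _).
rewrite exchange_big mulr_sumr; apply: eq_bigr => a aS.
rewrite exchange_big (bigD1 a) //= [X in _ + X]big1 => [|b /andP[_ ba]].
  by rewrite -mulr_sumr (sum_echar_dot R p_pr) subrr eqxx addr0 mulrC mulfK ?Fpn_neq0.
by rewrite -mulr_sumr (sum_echar_dot R p_pr) subr_eq0 (negPf ba) mulr0.
Qed.

(** [sigma] sorts magnitudes, which may coincide. Sorting the frequencies themselves by magnitude
    gives the same list after mapping, and S consists of the first k of them. *)
Lemma sigma_tail (f : V -> R) k :
  exists2 S : {set V}, (#|S| <= k)%N &
    sigma f k = \sum_(a in ~: S) normc (fhat f a) ^+ 2.
Proof.
rewrite /sigma sort_map -map_drop big_map.
set s := sort _ _.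
have us : uniq s by rewrite sort_uniq enum_uniq.
have sT a : a \in s by rewrite mem_sort mem_enum.
exists [set a in take k s].
  by rewrite cardsE (leq_trans (card_size _)) // size_take_min geq_minl.
rewrite big_uniq ?drop_uniq //; apply: eq_bigl => a; rewrite !inE.
have := sT a; move: us; rewrite -{1 2}(cat_take_drop k s) cat_uniq mem_cat.
case/and3P => _ /hasPn /(_ a) h _ /orP[at_|ad]; last by rewrite ad; apply/esym/h.
by rewrite at_; apply/negbTE/negP => /h; rewrite /= at_.
Qed.

End Fourier.

(** * Three-term counts weighted by a measure on the common difference *)

Section TrilinearForm.
Variables (R : realType) (p n : nat).
Hypothesis p_pr : prime p.
Local Notation V := 'rV['F_p]_n.
Local Notation N := ((p ^ n)%:R).
Local Notation normc := (@ComplexField.Normc.normc R).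
Variables (al be : 'F_p).

Definition trilin (mu h : V -> R) (u v : V -> R[i]) : R[i] :=
  N^-1 * \sum_(m : V) \sum_(d : V)
    (mu d)%:C%C * (h m)%:C%C * (u (m + al *: d) * v (m + be *: d)).

Definition trilinR (mu h f : V -> R) : R :=
  N^-1 * \sum_(m : V) \sum_(d : V) mu d * h m * (f (m + al *: d) * f (m + be *: d)).

Lemma trilinRE mu h f :
  (trilinR mu h f)%:C%C = trilin mu h (fun m => (f m)%:C%C) (fun m => (f m)%:C%C).
Proof.
rewrite rmorphM fmorphV rmorph_nat rmorph_sum; congr (_ * _).
by apply: eq_bigr => m _; rewrite rmorph_sum; apply: eq_bigr => d _; rewrite !rmorphM.
Qed.

(** Expanding both projections into characters separates the sums over m and d. The measure then
    enters only through its coefficients at the points -(al a + be b). *)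
Lemma trilin_fproj mu h f S :
  trilin mu h (fproj f S) (fproj f S) = N^-1 ^+ 3 * \sum_(a in S) \sum_(b in S)
    fhat f a * fhat f b * fhat h (- (a + b)) * mhat mu (- (al *: a + be *: b)).
Proof.
rewrite exprS -mulrA; congr (_ * _).
transitivity (\sum_(m : V) \sum_(d : V) \sum_(a in S) \sum_(b in S)
    N^-1 ^+ 2 * (fhat f a * fhat f b * ((h m)%:C%C * echar R (dotF (- (a + b)) m)) *
    ((mu d)%:C%C * echar R (dotF (- (al *: a + be *: b)) d)))).
  apply: eq_bigr => m _; apply: eq_bigr => d _.
  rewrite /fproj [X in _ * X]mulrACA -[N^-1 * N^-1]expr2 [LHS]mulrCA.
  under [in RHS]eq_bigr => a _ do rewrite -mulr_sumr.
  rewrite -[RHS]mulr_sumr; congr (_ * _).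
  rewrite mulr_suml mulr_sumr; apply: eq_bigr => a _.
  rewrite !mulr_sumr; apply: eq_bigr => b _.
  rewrite -!mulrA [RHS]mulrC.
  have -> : echar R (dotF a (- (m + al *: d))) * (fhat f b * echar R (dotF b (- (m + be *: d))))
     = fhat f b * (echar R (dotF (- (a + b)) m) * echar R (dotF (- (al *: a + be *: b)) d)).
    rewrite mulrCA -!(echarD R p_pr); congr (_ * echar R _).
    by rewrite !(dotFNl, dotFNr, dotFDl, dotFDr, dotFZl, dotFZr); ring.
  by ring.
rewrite [RHS]mulr_sumr.
under eq_bigr => m _ do rewrite exchange_big.
rewrite exchange_big; apply: eq_bigr => a _.
rewrite [RHS]mulr_sumr.
under eq_bigr => m _ do rewrite exchange_big.
rewrite exchange_big; apply: eq_bigr => b _.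
under eq_bigr => m _ do rewrite -mulr_sumr -mulr_sumr.
rewrite -mulr_sumr; congr (_ * _).
by rewrite -mulr_suml -mulr_sumr.
Qed.

Lemma trilin_fproj_eq mu nu h (f : V -> R) (S : {set V}) :
  (forall a b, a \in S -> b \in S ->
    mhat mu (- (al *: a + be *: b)) = mhat nu (- (al *: a + be *: b))) ->
  trilin mu h (fproj f S) (fproj f S) = trilin nu h (fproj f S) (fproj f S).
Proof.
move=> eq_mn; rewrite !trilin_fproj; congr (_ * _).
by apply: eq_bigr => a aS; apply: eq_bigr => b bS; rewrite eq_mn.
Qed.

Lemma sum_translate (mu phi : V -> R) (t : 'F_p) : \sum_d mu d = 1 ->
  \sum_(m : V) \sum_(d : V) mu d * phi (m + t *: d) = \sum_m phi m.
Proof.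
move=> mu1; rewrite exchange_big -[RHS]mul1r -mu1 mulr_suml; apply: eq_bigr => d _.
by rewrite -mulr_sumr [in RHS](reindex_inj (addIr (t *: d))).
Qed.

(** Only a and b are bounded, since a projection a - s may exceed 1 in modulus. The cross term st is
    split by the arithmetic-geometric inequality, so that the bound is a function of s plus a
    function of t. *)
Lemma normr_prodB_le (a b s t : R[i]) : `|a| <= 1 -> `|b| <= 1 ->
  `|a * b - (a - s) * (b - t)| <=
    ((normc s + normc s ^+ 2 / 2) + (normc t + normc t ^+ 2 / 2))%:C%C.
Proof.
move=> a1 b1.
have -> : a * b - (a - s) * (b - t) = s * b + a * t - s * t by ring.
apply: (@le_trans _ _ (`|s| + `|t| + `|s| * `|t|)).
  rewrite (le_trans (ler_normB _ _)) // normrM lerD2r (le_trans (ler_normD _ _)) //.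
  by rewrite !normrM lerD // ?ler_piMr ?ler_piMl.
rewrite !normcEC -!(rmorphM, rmorphD) /= lecR.
move: (normc s : R) (normc t : R) => x y.
have := sqr_ge0 (x - y). nra.
Qed.

(** By [normr_prodB_le] the error is at most a function of m + al d plus one of m + be d. For each
    fixed d these are translates in m, so the bound does not depend on mu. *)
Lemma trilin_sub_le mu h f (t : V -> R[i]) c :
  (forall d, 0 <= mu d) -> \sum_d mu d = 1 ->
  (forall m, 0 <= h m <= c) -> (forall m, 0 <= f m <= 1) ->
  `|(trilinR mu h f)%:C%C - trilin mu h (fun m => (f m)%:C%C - t m)
                                        (fun m => (f m)%:C%C - t m)| <=
  (2 * c * (N^-1 * \sum_m (normc (t m) + normc (t m) ^+ 2 / 2)))%:C%C.
Proof.
move=> mu0 mu1 h0c f01.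
have c0 : 0 <= c by have /andP[h0] := h0c 0; apply: le_trans.
have f1 m : `|(f m)%:C%C| <= 1 :> R[i].
  by have /andP[f0 f1] := f01 m; rewrite ger0_norm ?lecR.
pose phi m := normc (t m) + normc (t m) ^+ 2 / 2.
have phi0 m : 0 <= phi m.
  by rewrite addr_ge0 ?divr_ge0 ?sqr_ge0 // -lecR -normcEC normr_ge0.
rewrite trilinRE /trilin -mulrBr -sumrB.
apply: (@le_trans _ _ (N^-1 * (\sum_(m : V) \sum_(d : V)
    (mu d * c * (phi (m + al *: d) + phi (m + be *: d)))%:C%C))); last first.
  rewrite -(rmorph_nat (real_complex R)) -fmorphV.
  under eq_bigr => m _ do rewrite -rmorph_sum.
  rewrite -rmorph_sum -rmorphM lecR.
  rewrite (eq_bigr (fun m => c * (\sum_d mu d * phi (m + al *: d) +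
                                  \sum_d mu d * phi (m + be *: d)))) => [|m _].
    by rewrite -mulr_sumr big_split /= !sum_translate // -/phi; lra.
  by rewrite mulrDr !mulr_sumr -big_split; apply: eq_bigr => d _ /=; ring.
rewrite normrM normfV normr_nat ler_wpM2l ?invr_ge0 ?ler0n //.
rewrite (le_trans (ler_norm_sum _ _ _)) // ler_sum // => m _.
rewrite -sumrB (le_trans (ler_norm_sum _ _ _)) // ler_sum // => d _.
have /andP[h0 hc] := h0c m.
have e : `|(mu d)%:C%C * (h m)%:C%C| = (mu d * h m)%:C%C :> R[i].
  by rewrite -rmorphM ger0_norm // lecR mulr_ge0.
rewrite -mulrBr normrM e [leRHS]rmorphM.
apply: ler_pM; [by rewrite lecR mulr_ge0|exact: normr_ge0|by rewrite lecR ler_wpM2l|].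
exact: normr_prodB_le.
Qed.

(** All terms are nonnegative; only d = 0 is kept. *)
Lemma trilinR_lower mu h f : (forall d, 0 <= mu d) -> (forall m, 0 <= h m) ->
  (forall m, 0 <= f m) ->
  mu 0 * (N^-1 * \sum_m h m * f m ^+ 2) <= trilinR mu h f.
Proof.
move=> mu0 h0 f0; rewrite mulrCA ler_wpM2l ?invr_ge0 ?ler0n // mulr_sumr ler_sum // => m _.
rewrite (bigD1 0) //= !scaler0 !addr0 -expr2 mulrA lerDl sumr_ge0 // => d _.
by rewrite !mulr_ge0.
Qed.

End TrilinearForm.

(** * Elementary properties of the mean *)

Section Averages.
Variables (R : realType) (p n : nat).
Hypothesis p_pr : prime p.
Local Notation V := 'rV['F_p]_n.

Lemma Fcard_gt0 : 0 < Fcard R p n.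
Proof. by rewrite FcardE // ltr0n expn_gt0 prime_gt0. Qed.

Lemma Eavg_le (x y : V -> R) : (forall m, x m <= y m) -> Eavg x <= Eavg y.
Proof.
by move=> xy; rewrite ler_wpM2l ?invr_ge0 ?(ltW Fcard_gt0) ?ler_sum.
Qed.

Lemma Eavg_cst (c : R) : Eavg (fun _ : V => c) = c.
Proof.
by rewrite /Eavg sumr_const -[c *+ _]mulr_natl mulKf // gt_eqF // Fcard_gt0.
Qed.

Lemma EavgD (x y : V -> R) : Eavg (fun m => x m + y m) = Eavg x + Eavg y.
Proof. by rewrite /Eavg big_split mulrDr. Qed.

Lemma EavgZ (c : R) (x : V -> R) : Eavg (fun m => c * x m) = c * Eavg x.
Proof. by rewrite /Eavg -mulr_sumr mulrCA. Qed.

Lemma Eavg_sqr_le (x : V -> R) : Eavg x ^+ 2 <= Eavg (fun m => x m ^+ 2).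
Proof.
set A := Eavg x.
have : Eavg (fun _ : V => 0 : R) <= Eavg (fun m => x m ^+ 2 + (- (2 * A) * x m + A ^+ 2)).
  by apply: Eavg_le => m; have := sqr_ge0 (x m - A); nra.
by rewrite !EavgD EavgZ !Eavg_cst -/A; nra.
Qed.

End Averages.

(** * Lower bound for the count with uniform differences *)

Section Counting.
Variables (R : realType) (p n k : nat).
Hypothesis p_pr : prime p.
Hypothesis k_gt0 : (0 < k)%N.
Local Notation V := 'rV['F_p]_n.
Local Notation N := ((p ^ n)%:R).
Local Notation normc := (@ComplexField.Normc.normc R).
Variables (f : V -> R) (delta : R).
Hypothesis delta0 : 0 <= delta.
Hypothesis f01 : forall m, 0 <= f m <= 1.
Hypothesis f_tail : sigma f k <= delta ^+ 2 * N ^+ 2.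

Lemma mhat0 (mu : V -> R) : mhat mu 0 = (\sum_d mu d)%:C%C.
Proof.
rewrite /mhat rmorph_sum; apply: eq_bigr => d _ /=.
by rewrite -[X in dotF X _](scale0r 0) dotFZl mul0r echar0 mulr1.
Qed.

(** Parseval and the tail hypothesis bound the second moment by delta^2; Cauchy-Schwarz then bounds
    the first moment by delta. *)
Lemma tail_mean_le (S : {set V}) : sigma f k = \sum_(a in ~: S) normc (fhat f a) ^+ 2 ->
  N^-1 * \sum_m (normc (fproj f (~: S) m) + normc (fproj f (~: S) m) ^+ 2 / 2)
    <= delta + delta ^+ 2 / 2.
Proof.
move=> sigmaE; pose x m : R := normc (fproj f (~: S) m).
have x2 : Eavg (fun m => x m ^+ 2) <= delta ^+ 2.
  rewrite /Eavg FcardE // parseval_fproj // -sigmaE mulrA -expr2 exprVn mulrC.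
  by rewrite ler_pdivrMr // exprn_gt0 // ltr0n expn_gt0 prime_gt0.
have x1 : Eavg x <= delta.
  rewrite -(@ler_pXn2r _ 2) ?nnegrE //; first exact: le_trans (Eavg_sqr_le p_pr x) x2.
  rewrite mulr_ge0 ?invr_ge0 ?(ltW (Fcard_gt0 _ _ p_pr)) // sumr_ge0 // => m _.
  by rewrite -lecR -normcEC normr_ge0.
have -> : N^-1 * \sum_m (x m + x m ^+ 2 / 2) = Eavg x + Eavg (fun m => x m ^+ 2) / 2.
  by rewrite /Eavg FcardE // big_split -mulr_suml /= mulrDr mulrA.
by rewrite lerD // ler_pM2r ?invr_gt0.
Qed.

Lemma exists_measure_avoiding (S : {set V}) (al be : 'F_p) : (#|S| <= k)%N ->
  exists mu : V -> R, [/\ forall d, 0 <= mu d, \sum_d mu d = 1,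
    (p * k ^ 2)%:R^-1 <= mu 0 &
    forall a b, a \in S -> b \in S ->
      mhat mu (- (al *: a + be *: b)) = mhat (fun=> N^-1) (- (al *: a + be *: b))].
Proof.
move=> Sk; pose D := [set - (al *: a + be *: b) | a in S, b in S] :\ 0.
have D0 : 0 \notin D by rewrite !inE eqxx.
have Dk : (#|D| <= k ^ 2)%N.
  rewrite (leq_trans (subset_leq_card (subD1set _ _))) // curry_imset2X.
  by rewrite (leq_trans (leq_imset_card _ _)) // cardsX leq_mul.
have p_gt1 := prime_gt1 p_pr.
(* With j - 1 the integer part of log_p(k^2), one has k^2 < p^j <= p k^2: the left inequality
   permits the construction, the right one bounds mu(0) below. *)
have [|mu [mu0 mu1 muj muD]] := exists_sparse_measure R p_pr (j := (trunc_log p (k ^ 2)).+1) D0.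
  exact: leq_ltn_trans Dk (trunc_log_ltn _ p_gt1).
exists mu; split => [//|//||a b aS bS].
  rewrite (le_trans _ muj) // lef_pV2 ?posrE ?ltr0n ?muln_gt0 ?expn_gt0 ?(prime_gt0 p_pr) ?k_gt0 //.
  by rewrite ler_nat expnS leq_mul2l trunc_logP ?orbT // expn_gt0 k_gt0.
rewrite [RHS](mhat_uniform R p_pr); set v := - _.
case: eqP => [->|/eqP v0]; first by rewrite mhat0 mu1.
by rewrite muD // !inE v0 /=; apply: imset2_f.
Qed.

Lemma trilinR_uniform_ge (al be : 'F_p) (h : V -> R) (c : R) :
  (forall m, 0 <= h m <= c) ->
  Eavg (fun m => h m * f m ^+ 2) / (p%:R * k%:R ^+ 2)
    - 2 * c * (2 * delta + delta ^+ 2) <= trilinR al be (fun=> N^-1) h f.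
Proof.
move=> h0c; have [S Sk sigmaE] := sigma_tail f k.
have [mu [mu0 mu1 muk muS]] := exists_measure_avoiding al be Sk.
have eps := tail_mean_le sigmaE; move: eps; set e := (X in X <= _) => eps.
have c0 : 0 <= c by have /andP[h0] := h0c 0; apply: le_trans.
have Nn0 : N != 0 :> R by exact: Fpn_neq0.
have N_ge0 : 0 <= N^-1 :> R by rewrite invr_ge0 ler0n.
have nu1 : \sum_(d : V) N^-1 = 1 :> R.
  by rewrite sumr_const card_Fvec // -[_ *+ _]mulr_natl divff.
have := trilin_sub_le al be (fproj f (~: S)) (fun _ => N_ge0) nu1 h0c f01.
have := trilin_sub_le al be (fproj f (~: S)) mu0 mu1 h0c f01.
have -> : (fun m => (f m)%:C%C - fproj f (~: S) m) = fproj f S.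
  by apply/funext => m; rewrite fprojC // subKr.
rewrite (trilin_fproj_eq p_pr h f muS) -/e.
(* X is the projected count, the same for mu and for the uniform measure; both true counts are
   within 2ce of it. *)
set X := trilin _ _ _ _ _ _ => dmu dnu.
have : `|(trilinR al be mu h f - trilinR al be (fun=> N^-1) h f)%:C%C|
    <= (2 * c * e + 2 * c * e)%:C%C.
  rewrite [leRHS]rmorphD rmorphB /=.
  have -> : forall a b : R[i], a - b = (a - X) - (b - X) by move=> a b; ring.
  by rewrite (le_trans (ler_normB _ _)) // lerD.
have := trilinR_lower al be mu0 (fun m => proj1 (andP (h0c m))) (fun m => proj1 (andP (f01 m))).
rewrite normcEC lecR /= expr0n /= addr0 sqrtr_sqr => low /ler_normlP[_ dif].
have main : Eavg (fun m => h m * f m ^+ 2) / (p%:R * k%:R ^+ 2) <= 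
    mu 0 * (N^-1 * \sum_m h m * f m ^+ 2).
  rewrite /Eavg FcardE // mulrC ler_wpM2r ?mulr_ge0 ?sumr_ge0 // => [m _|].
    by have /andP[h0 _] := h0c m; rewrite mulr_ge0 ?sqr_ge0.
  by rewrite -natrX -natrM.
(* The total loss 4ce is thus at most 2c(2 delta + delta^2). *)
have ce : c * e <= c * (delta + delta ^+ 2 / 2) by rewrite ler_wpM2l.
lra.
Qed.

End Counting.

(** * From the weighted forms back to [Lambda3] *)

Section Comparison.
Variables (R : realType) (p n : nat).
Hypothesis p_pr : prime p.
Local Notation V := 'rV['F_p]_n.
Local Notation N := ((p ^ n)%:R).
Variables (f g h : V -> R).
Hypothesis f0 : forall m, 0 <= f m.
Hypothesis hg : forall m, h m <= g m.

Lemma trilinR_le_Lambda3_fgf : trilinR (-1) 1 (fun=> N^-1) h f <= Lambda3 f g f.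
Proof.
rewrite /Lambda3 /trilinR FcardE // -exprVn expr2 -mulrA ler_wpM2l ?invr_ge0 ?ler0n //.
rewrite mulr_sumr [leRHS](_ : _ = \sum_m \sum_d N^-1 * (g m * (f (m - d) * f (m + d)))).
  apply: ler_sum => m _; apply: ler_sum => d _.
  by rewrite scaleN1r scale1r -mulrA ler_wpM2l ?invr_ge0 ?ler0n // ler_wpM2r ?mulr_ge0.
under eq_bigr => m _ do rewrite mulr_sumr.
rewrite exchange_big [RHS]exchange_big; apply: eq_bigr => d _ /=.
(* Recentre the progression at its middle term, where g sits. *)
rewrite (reindex_inj (addIr (- d))); apply: eq_bigr => m _ /=.
by rewrite subrK; ring.
Qed.

Lemma trilinR_le_Lambda3_gff : trilinR 1 (1 + 1) (fun=> N^-1) h f <= Lambda3 g f f.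
Proof.
rewrite /Lambda3 /trilinR FcardE // -exprVn expr2 -mulrA ler_wpM2l ?invr_ge0 ?ler0n //.
rewrite mulr_sumr; apply: ler_sum => m _; rewrite mulr_sumr; apply: ler_sum => d _.
rewrite scalerDl !scale1r !addrA -!mulrA ler_wpM2l ?invr_ge0 ?ler0n //.
by rewrite ler_wpM2r ?mulr_ge0.
Qed.

End Comparison.

(** * Numerical estimates and conclusion *)

Lemma Lambda3_ge0 (R : realType) (p n : nat) (f1 f2 f3 : 'rV['F_p]_n -> R) :
  (forall m, 0 <= f1 m) -> (forall m, 0 <= f2 m) -> (forall m, 0 <= f3 m) ->
  0 <= Lambda3 f1 f2 f3.
Proof.
move=> h1 h2 h3; rewrite mulr_ge0 ?invr_ge0 ?exprn_ge0 ?ler0n //.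
by rewrite sumr_ge0 // => m _; rewrite sumr_ge0 // => d _; rewrite !mulr_ge0.
Qed.

(** Here 4 C(k,2) = 2k(k-1), and 2(k-1) >= k once k >= 2. *)
Lemma sqr_le_bin2 k : (2 <= k)%N -> (k ^ 2 <= 4 * 'C(k, 2))%N.
Proof.
case: k => [|[|k]] // _; have := bin_ffact k.+2 2.
have -> : (2`! = 2)%N by [].
rewrite ffactnS ffactn1 -[4%N]/(2 * 2)%N -mulnA [(2 * 'C(_, _))%N]mulnC => ->.
by rewrite mulnCA leq_mul2l /= mul2n -addnn addSn ltnS leq_addl.
Qed.

(** Pointwise, min(g,c) f^2 >= min(g,c) g^2 >= c g^2 - c^3: when g <= c the right side is
    nonpositive. Then E(g^2) >= E(g)^2. *)
Lemma Eavg_truncated_ge (R : realType) (p n : nat) (f g : 'rV['F_p]_n -> R) (c : R) :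
  prime p -> 0 <= c -> (forall m, 0 <= g m <= f m) ->
  c * (Eavg g ^+ 2 - c ^+ 2) <= Eavg (fun m => Num.min (g m) c * f m ^+ 2).
Proof.
move=> p_pr c0 gf; apply: (@le_trans _ _ (Eavg (fun m => c * g m ^+ 2 + - c ^+ 3))).
  rewrite EavgD EavgZ Eavg_cst // mulrBr exprS lerD2r.
  by rewrite ler_wpM2l // Eavg_sqr_le.
apply: Eavg_le => // m; have /andP[g0 gfm] := gf m.
apply: (@le_trans _ _ (Num.min (g m) c * g m ^+ 2)).
  case: (leP (g m) c) => gc; last by rewrite lerBlDr lerDl exprn_ge0.
  have : c * g m ^+ 2 <= c * c ^+ 2 by rewrite ler_wpM2l // lerXn2r.
  have : 0 <= g m * g m ^+ 2 by rewrite mulr_ge0 ?sqr_ge0.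
  by rewrite exprS; lra.
by rewrite ler_wpM2l ?le_min ?g0 // lerXn2r ?nnegrE // (le_trans g0).
Qed.

(** If A T <= 9 delta / 8, the claimed bound is nonpositive. Otherwise delta <= 1/4, so 2 delta +
    delta^2 <= 9 delta / 4 and the loss is at most 9 delta G / 8; the main term is at least 15 G^2 M
    / 64 >= A G^2, and x (A x - 9 delta / 8) grows from T to G. *)
Lemma bound_arith (R : realFieldType) (A M G T delta L : R) :
  0 <= A -> A <= M / 64 -> M <= 1 -> 0 < T -> T <= G -> G <= 1 -> 0 <= delta ->
  0 <= L -> G / 4 * (G - (G / 4) ^+ 2) * M - 2 * (G / 4) * (2 * delta + delta ^+ 2) <= L ->
  A * T ^+ 2 - 9 * delta * T / 8 <= L.
Proof.
move=> A0 AM M1 T0 TG G1 d0 L0 LM.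
have [AT|AT] := leP (A * T) (9 / 8 * delta).
  have : T * (A * T) <= T * (9 / 8 * delta) by rewrite ler_pM2l.
  by rewrite expr2; lra.
have G0 : 0 < G by apply: lt_le_trans TG.
have AT1 : A * T <= A by rewrite ler_piMr //; lra.
have d1 : delta <= 1 / 4 by lra.
have dd : delta ^+ 2 <= delta / 4 by rewrite expr2; nra.
have ATG : A * T <= A * G by rewrite ler_wpM2l.
have t1 : T * (A * T - 9 / 8 * delta) <= G * (A * G - 9 / 8 * delta).
  by apply: ler_pM => //; lra.
have t2 : A * G ^+ 2 <= M / 64 * G ^+ 2 by rewrite ler_wpM2r ?sqr_ge0.
have t3 : G / 4 * (G - (G / 4) ^+ 2) >= 15 / 64 * G ^+ 2.
  have : G ^+ 2 * G <= G ^+ 2 * 1 by rewrite ler_wpM2l ?sqr_ge0.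
  by rewrite !expr2; lra.
have t4 : 15 / 64 * G ^+ 2 * M <= G / 4 * (G - (G / 4) ^+ 2) * M by rewrite ler_wpM2r //; lra.
have t5 : G * delta ^+ 2 <= G * (delta / 4) by rewrite ler_wpM2l // ltW.
have t6 : 0 <= M * G ^+ 2 by rewrite mulr_ge0 ?sqr_ge0 //; lra.
move: t1 t2 t4 LM t5 t6; rewrite !expr2; lra.
Qed.

Theorem theorem1 (R : realType) (p n k : nat) (theta delta : R)
    (f g : 'rV['F_p]_n -> R) :
  prime p -> (1 <= n)%N -> (2 <= k <= p ^ n)%N -> 0 <= delta ->
  (forall m, 0 <= g m /\ g m <= f m /\ f m <= 1) ->
  Eavg f >= Eavg g ->
  Eavg g >= Num.max ((p ^ n)%:R `^ (- theta))
                    (8 * (p%:R `^ (- (2^-1))) * (k%:R)^-1) ->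
  sigma f k <= delta ^+ 2 * ((p ^ n)%:R) ^+ 2 ->
  let bound := (p%:R) ^- 2 * ('C(k, 2))%:R^-1 * ((p ^ n)%:R `^ (-4 * theta)) / 128
               - 9 * delta * ((p ^ n)%:R `^ (-2 * theta)) / 8 in
  Lambda3 f g f >= bound /\ Lambda3 g f f >= bound.
Proof.
move=> p_pr _ /andP[k2 _] delta0 gf _ gamma_ge tail bound.
have g0 m : 0 <= g m by case: (gf m).
have f01 m : 0 <= f m <= 1.
  by have [gm [fm ->]] := gf m; rewrite (le_trans gm fm).
have f0 m : 0 <= f m by case/andP: (f01 m).
move: gamma_ge; rewrite ge_max => /andP[tau_le _].
set gamma := Eavg g in tau_le; set tau := _ `^ _ in tau_le.
have tau0 : 0 < tau by rewrite powR_gt0 // ltr0n expn_gt0 prime_gt0.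
have gamma1 : gamma <= 1.
  rewrite -(Eavg_cst n p_pr 1); apply: Eavg_le => // m.
  by have [_ [gfm fm]] := gf m; apply: le_trans fm.
(* Truncating at order gamma^2 gives the loss a factor gamma^2, while the main term keeps order
   gamma^4 because c^2 <= gamma^2 / 16. *)
pose c := gamma ^+ 2 / 4; pose h m := Num.min (g m) c.
have c0 : 0 <= c by rewrite divr_ge0 ?sqr_ge0.
have h0c m : 0 <= h m <= c by rewrite le_min g0 c0 ge_min lexx orbT.
have hg m : h m <= g m by rewrite ge_min lexx.
pose M : R := (p%:R * k%:R ^+ 2)^-1.
have bound_le L : 0 <= L ->
    Eavg (fun m => h m * f m ^+ 2) * M - 2 * c * (2 * delta + delta ^+ 2) <= L ->
    bound <= L.
  move=> L0 LM.
  have tauE s : (p ^ n)%:R `^ (- s%:R * theta) = tau ^+ s :> R.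
    by rewrite mulNr -mulrN mulrC powRrM powR_mulrn // ltW.
  have tau_sq : tau ^+ 2 <= gamma ^+ 2 by rewrite lerXn2r ?nnegrE // ?ltW // (lt_le_trans tau0).
  pose A : R := p%:R ^- 2 * ('C(k, 2))%:R^-1 / 128.
  have -> : bound = A * (tau ^+ 2) ^+ 2 - 9 * delta * tau ^+ 2 / 8.
    by rewrite /bound !tauE /A; ring.
  apply: (@bound_arith _ _ M (gamma ^+ 2)) => //.
  - by rewrite divr_ge0 // mulr_ge0 ?invr_ge0 ?exprn_ge0 ?ler0n.
  (* A <= M / 64 amounts to k^2 <= 2 p C(k,2), which follows from k^2 <= 4 C(k,2) and p >= 2. *)
  - have p2 : (2 : R) <= p%:R by rewrite (ler_nat _ 2) prime_gt1.
    have kC : k%:R ^+ 2 <= 4 * ('C(k, 2))%:R :> R by rewrite -natrX -natrM ler_nat sqr_le_bin2.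
    have k0 : 0 < k%:R :> R by rewrite ltr0n (leq_trans _ k2).
    have C0 : 0 < ('C(k, 2))%:R :> R by rewrite ltr0n bin_gt0.
    have p0 : 0 < p%:R :> R by lra.
    rewrite /A /M -!invfM lef_pV2 ?posrE ?mulr_gt0 ?exprn_gt0 //.
    have : p%:R * k%:R ^+ 2 <= p%:R * (4 * ('C(k, 2))%:R) :> R by rewrite ler_pM2l.
    have : 2 * (p%:R * ('C(k, 2))%:R) <= p%:R * (p%:R * ('C(k, 2))%:R) :> R.
      by rewrite ler_pM2r ?mulr_gt0.
    by rewrite [p%:R ^+ 2]expr2; lra.
  - have q_gt0 : (0 < p * k ^ 2)%N.
      by rewrite muln_gt0 expn_gt0 prime_gt0 // (leq_trans _ k2).
    by rewrite /M -natrX -natrM invf_le1 ?ltr0n // (ler_nat _ 1).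
  - exact: exprn_gt0.
  - by rewrite expr_le1 // ltW // (lt_le_trans tau0).
  - apply: le_trans LM; rewrite lerD2r ler_wpM2r //.
      by rewrite invr_ge0 mulr_ge0 ?exprn_ge0 ?ler0n.
    by apply: Eavg_truncated_ge => // m; rewrite g0; case: (gf m) => _ [].
have k_gt0 : (0 < k)%N by apply: leq_trans k2.
split; apply: bound_le; rewrite ?Lambda3_ge0 //.
- apply: le_trans (trilinR_le_Lambda3_fgf p_pr f0 hg).
  exact: trilinR_uniform_ge.
apply: le_trans (trilinR_le_Lambda3_gff p_pr f0 hg).
exact: trilinR_uniform_ge.
Qed.
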